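(* Let $X$ be a locally path connected space, let $x\in X$, and let $H$ be a subgroup of $\pi_1(X,x)$ such that the core of $H$ in $\pi_1(X,x)$ is open in $\pi_1^{qtop}(X,x)$. Then there exists an open cover $\mathcal{U}$ of $X$ such that $\pi(\mathcal{U},x)\leq H$.
   Context: The quasitopological fundamental group $\pi_1^{qtop}(X,x)$ is the group $\pi_1(X,x)$ with the quotient topology induced by the map $q:\Omega(X,x)\to\pi_1(X,x)$, $q(\gamma)=[\gamma]$, where $\Omega(X,x)$ is the space of loops in $X$ based at $x$ with the compact-open topology. For a subgroup $H$ of a group $G$, the core of $H$ in $G$ is $H_G=\bigcap_{g\in G}g^{-1}Hg$, the largest normal subgroup of $G$ contained in $H$. For an open cover $\mathcal{U}=\{U_i\mid i\in I\}$ of $X$, the Spanier group $\pi(\mathcal{U},x)$ is the subgroup of $\pi_1(X,x)$ consisting of all homotopy classes having a representative of the form $\prod_{j=1}^{n}u_jv_ju_j^{-1}$, where each $u_j$ is an arbitrary path starting at $x$ and each $v_j$ is a loop based at $u_j(1)$ lying inside one of the open sets of $\mathcal{U}$. *)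

(* Defs.v *)
From HB Require Import structures.
From mathcomp Require Import all_boot all_order all_algebra.
From mathcomp Require Import all_classical all_reals topology normedtype.
From mathcomp Require Import homotopy.
From mathcomp Require Import lra.

Set Implicit Arguments.
Unset Strict Implicit.
Unset Printing Implicit Defensive.

Import Order.TTheory GRing.Theory Num.Theory.
Import numFieldNormedType.Exports.

Local Open Scope classical_set_scope.
Local Open Scope ring_scope.
Local Open Scope quotient_scope.

(* Unlike `subspace`, the subtype gives paths that are total on [0, 1] and hence
   the right compact-open topology. *)
Definition unit_interval (R : realType) : Type := set_type `[0 : R, 1]%classic.

HB.instance Definition _ (R : realType) :=
  Topological.copy (unit_interval R) (set_type `[0 : R, 1]%classic).

Section unit_interval.
Context {R : realType}.
Local Notation I := (unit_interval R).

Definition ival (t : I) : R := set_val t.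

Lemma ival_ge0 t : 0 <= ival t.
Proof. by have := set_valP t; rewrite /= in_itv /= => /andP[]. Qed.

Lemma ival_le1 t : ival t <= 1.
Proof. by have := set_valP t; rewrite /= in_itv /= => /andP[]. Qed.

Lemma ival_inj : injective ival.
Proof. exact: val_inj. Qed.

Lemma clamp_subproof (r : R) :
  Order.max 0 (Order.min r 1) \in `[0 : R, 1]%classic.
Proof.
apply/mem_set; rewrite /= in_itv /= le_max lexx /= ge_max ler01 /=.
by rewrite ge_min lexx orbT.
Qed.

(* The retraction of R onto [0, 1], used to write paths and homotopies by formulas
   on real parameters. *)
Definition clamp (r : R) : I :=
  exist (fun s : R => s \in `[0 : R, 1]%classic) _ (clamp_subproof r).

Lemma ival_clamp r : ival (clamp r) = Order.max 0 (Order.min r 1).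
Proof. by rewrite /ival set_valE. Qed.

Lemma clampK r : 0 <= r <= 1 -> ival (clamp r) = r.
Proof. by move=> /andP[r0 r1]; rewrite ival_clamp min_l// max_r. Qed.

Lemma clamp_ge1 r : 1 <= r -> ival (clamp r) = 1.
Proof. by move=> r1; rewrite ival_clamp min_r// max_r. Qed.

Lemma clamp_le0 r : r <= 0 -> ival (clamp r) = 0.
Proof. by move=> r1; rewrite ival_clamp min_l ?(le_trans r1)// max_l. Qed.

Lemma ivalK : cancel ival clamp.
Proof.
by move=> t; apply: ival_inj; rewrite clampK// ival_ge0 ival_le1.
Qed.

Lemma ival_continuous : continuous ival.
Proof. exact: initial_continuous. Qed.

Lemma clamp_continuous : continuous clamp.
Proof.
have cf : continuous (fun r : R => Order.max (0 : R) (Order.min r (1 : R))).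
  move=> r; have := @continuous_max R R (cst 0) (id \min cst 1) r; apply.
    exact: cst_continuous.
  have := @continuous_min R R id (cst 1) r; apply; first exact: id.
  exact: cst_continuous.
apply/continuousP => _ [A oA <-].
by rewrite -comp_preimage set_valE; move/continuousP: cf; apply.
Qed.

Lemma clamp01_subproof : clamp 0 != clamp 1.
Proof.
apply/eqP => /(congr1 ival); rewrite !clampK ?lexx ?ler01//.
by move/eqP; rewrite eq_sym oner_eq0.
Qed.

HB.instance Definition _ :=
  @isBiPointed.Build I (clamp 0) (clamp 1) clamp01_subproof.

Lemma ival_zero : ival zero = 0.
Proof. by rewrite clampK// lexx ler01. Qed.

Lemma ival_one : ival one = 1.
Proof. by rewrite clampK// lexx ler01. Qed.

End unit_interval.

Lemma paste_continuous (R : realType) (Z Y : topologicalType)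
    (a : Z -> R) (c : R) (F G : Z -> Y) :
  continuous a -> continuous F -> continuous G ->
  (forall z, a z = c -> F z = G z) ->
  continuous (fun z => if a z <= c then F z else G z).
Proof.
move=> ca cF cG FG z U /=; case: (ltgtP (a z) c) => [azc|azc|azc] nU.
- have H : \forall w \near z, a w < c by exact: (ca z _ (lt_nbhsl azc)).
  have HF : \forall w \near z, U (F w) by exact: cF.
  rewrite /nbhs /=; near=> w; rewrite /=.
  have -> : a w <= c by apply: ltW; near: w.
  by near: w.
- have H : \forall w \near z, c < a w by exact: (ca z _ (lt_nbhsr azc)).
  have HF : \forall w \near z, U (G w) by exact: cG.
  rewrite /nbhs /=; near=> w; rewrite /=.
  have -> : (a w <= c) = false by apply/negbTE; rewrite -ltNge; near: w.
  by near: w.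
- have HF : \forall w \near z, U (F w) by exact: cF.
  have HG : \forall w \near z, U (G w) by apply: cG; rewrite -FG.
  rewrite /nbhs /=; near=> w; rewrite /=.
  by case: ifP => _; near: w.
Unshelve. all: by end_near. Qed.

Section path_operations.
Context {R : realType} {X : topologicalType}.
Local Notation I := (unit_interval R).
Implicit Types x y z : X.

Lemma affine_continuous (Z : topologicalType) (f : Z -> R) (a b : R) :
  continuous f -> continuous (fun w => a * f w + b).
Proof.
move=> cf w.
by apply: cvgD; [apply: cvgM; [exact: cvg_cst|exact: cf]|exact: cvg_cst].
Qed.

Lemma path_clamp_continuous (Z : topologicalType) (f : Z -> R) x y
    (p : {path I from x to y}) :
  continuous f -> continuous (fun w => p (clamp (f w))).
Proof.
move=> cf w; apply: (@continuous_comp _ _ _ (fun w => clamp (f w)) p).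
  apply: (@continuous_comp _ _ _ f clamp); first exact: cf.
  exact: clamp_continuous.
exact: cts_fun.
Qed.

Lemma path_clamp0 x y (p : {path I from x to y}) (r : R) :
  r <= 0 -> p (clamp r) = x.
Proof.
move=> r0; rewrite -[RHS](path_zero (s := p)); congr (p _); apply: ival_inj.
by rewrite clamp_le0// ival_zero.
Qed.

Lemma path_clamp1 x y (p : {path I from x to y}) (r : R) :
  1 <= r -> p (clamp r) = y.
Proof.
move=> r1; rewrite -[RHS](path_one (s := p)); congr (p _); apply: ival_inj.
by rewrite clamp_ge1// ival_one.
Qed.

Definition cat_fun (f g : I -> X) (t : I) : X :=
  if ival t <= 2^-1 then f (clamp (2 * ival t)) else g (clamp (2 * ival t - 1)).

Section cat.
Context x y z (p : {path I from x to y}) (q : {path I from y to z}).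

Lemma cat_fun_continuous : continuous (cat_fun p q).
Proof.
apply: (@paste_continuous R I X ival 2^-1 (fun t => p (clamp (2 * ival t)))
  (fun t => q (clamp (2 * ival t - 1)))).
- exact: ival_continuous.
- apply: path_clamp_continuous.
  have := @affine_continuous I ival 2 0 (@ival_continuous R).
  by under eq_fun do rewrite addr0.
- exact/path_clamp_continuous/affine_continuous/ival_continuous.
- move=> t ->; rewrite path_clamp1 ?path_clamp0//; lra.
Qed.

Lemma cat_fun_zero : cat_fun p q zero = x.
Proof. by rewrite /cat_fun ival_zero invr_ge0 ler0n path_clamp0// mulr0. Qed.

Lemma cat_fun_one : cat_fun p q one = z.
Proof.
rewrite /cat_fun ival_one ifF; last by apply/negbTE; rewrite -ltNge; lra.
by rewrite path_clamp1//; lra.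
Qed.

Definition path_cat : {path I from x to z} :=
  mk_path cat_fun_continuous cat_fun_zero cat_fun_one.

Lemma path_catE t : path_cat t =
  if ival t <= 2^-1 then p (clamp (2 * ival t)) else q (clamp (2 * ival t - 1)).
Proof. by []. Qed.

End cat.

Section rev.
Context x y (p : {path I from x to y}).

Definition rev_fun (f : I -> X) (t : I) : X := f (clamp (1 - ival t)).

Lemma rev_fun_continuous : continuous (rev_fun p).
Proof.
apply: path_clamp_continuous.
have := @affine_continuous I ival (-1) 1 (@ival_continuous R).
by under eq_fun do rewrite mulN1r addrC.
Qed.

Lemma rev_fun_zero : rev_fun p zero = y.
Proof. by rewrite /rev_fun ival_zero path_clamp1// subr0. Qed.

Lemma rev_fun_one : rev_fun p one = x.
Proof. by rewrite /rev_fun ival_one path_clamp0// subrr. Qed.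

Definition path_rev : {path I from y to x} :=
  mk_path rev_fun_continuous rev_fun_zero rev_fun_one.

Lemma path_revE t : path_rev t = p (clamp (1 - ival t)).
Proof. by []. Qed.

End rev.

Definition path_cst x : {path I from x to x} := cst x.

Definition path_homotopic x y (p q : {path I from x to y}) : Prop :=
  exists h : I * I -> X,
    [/\ continuous h,
        forall t, h (t, zero) = p t, forall t, h (t, one) = q t,
        forall s, h (zero, s) = x & forall s, h (one, s) = y].

End path_operations.

Section homotopy_theory.
Context {R : realType} {X : topologicalType}.
Local Notation I := (unit_interval R).
Implicit Types x y z : X.

Lemma path_clampE x y (p : {path I from x to y}) t : p (clamp (ival t)) = p t.
Proof. by rewrite ivalK. Qed.

Lemma fst_ival_continuous : continuous (fun w : I * I => ival w.1).
Proof.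
move=> w; apply: (@continuous_comp _ _ _ (fst : I * I -> I) ival).
  exact: cvg_fst.
exact: ival_continuous.
Qed.

Lemma snd_ival_continuous : continuous (fun w : I * I => ival w.2).
Proof.
move=> w; apply: (@continuous_comp _ _ _ (snd : I * I -> I) ival).
  exact: cvg_snd.
exact: ival_continuous.
Qed.

Lemma homotopy_comp_continuous (h : I * I -> X) (f g : I * I -> R) :
  continuous h -> continuous f -> continuous g ->
  continuous (fun w => h (clamp (f w), clamp (g w))).
Proof.
move=> ch cf cg w.
have cF : clamp (f v) @[v --> w] --> clamp (f w).
  apply: (@continuous_comp _ _ _ f clamp); first exact: cf.
  exact: clamp_continuous.
have cG : clamp (g v) @[v --> w] --> clamp (g w).
  apply: (@continuous_comp _ _ _ g clamp); first exact: cg.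
  exact: clamp_continuous.
apply: (@continuous_comp _ _ _ (fun w => (clamp (f w), clamp (g w))) h).
  exact: (cvg_pair cF cG).
exact: ch.
Qed.

Lemma interpolation_continuous (Z : topologicalType) (f g k : Z -> R) :
  continuous f -> continuous g -> continuous k ->
  continuous (fun w => f w + k w * (g w - f w)).
Proof.
move=> cf cg ck w; have cfw := cf w; have cgw := cg w; have ckw := ck w.
by apply: (cvgD cfw); apply: (cvgM ckw); exact: (cvgB cgw cfw).
Qed.

Lemma reparam_homotopic x y a b (p : {path I from x to y})
    (f g : {path I from a to b}) (phi psi : I -> R) :
  continuous phi -> continuous psi ->
  phi zero = psi zero -> phi one = psi one ->
  (forall t, f t = p (clamp (phi t))) -> (forall t, g t = p (clamp (psi t))) ->
  path_homotopic f g.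
Proof.
move=> cphi cpsi e0 e1 fE gE.
exists (fun w => p (clamp (phi w.1 + ival w.2 * (psi w.1 - phi w.1)))); split.
- apply: path_clamp_continuous; apply: interpolation_continuous.
  + move=> v; apply: (@continuous_comp _ _ _ (fst : I * I -> I) phi).
      exact: cvg_fst.
    exact: cphi.
  + move=> v; apply: (@continuous_comp _ _ _ (fst : I * I -> I) psi).
      exact: cvg_fst.
    exact: cpsi.
  + exact: snd_ival_continuous.
- by move=> t /=; rewrite ival_zero mul0r addr0 fE.
- by move=> t /=; rewrite ival_one mul1r addrC subrK gE.
- move=> s /=; rewrite e0 subrr mulr0 addr0 -e0 -fE; exact: path_zero.
- move=> s /=; rewrite e1 subrr mulr0 addr0 -e1 -fE; exact: path_one.
Qed.

Lemma path_homotopic_refl x y (p : {path I from x to y}) : path_homotopic p p.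
Proof.
by apply: (@reparam_homotopic x y x y p p p ival ival) => //;
  [exact: ival_continuous|exact: ival_continuous|move=> t..];
  rewrite path_clampE.
Qed.

Lemma path_homotopic_sym x y (p q : {path I from x to y}) :
  path_homotopic p q -> path_homotopic q p.
Proof.
move=> [h [ch h0 h1 hx hy]].
exists (fun w => h (clamp (ival w.1), clamp (-1 * ival w.2 + 1))); split.
- apply: homotopy_comp_continuous => //; first exact: fst_ival_continuous.
  exact/affine_continuous/snd_ival_continuous.
- by move=> t /=; rewrite ival_zero mulr0 add0r ivalK h1.
- by move=> t /=; rewrite ival_one mulr1 addNr ivalK h0.
- by move=> s /=; rewrite ivalK hx.
- by move=> s /=; rewrite ivalK hy.
Qed.

Lemma path_homotopic_trans x y (q p r : {path I from x to y}) :
  path_homotopic p q -> path_homotopic q r -> path_homotopic p r.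
Proof.
move=> [h [ch h0 h1 hx hy]] [k [ck k0 k1 kx ky]].
exists (fun w => if ival w.2 <= 2^-1
  then h (clamp (ival w.1), clamp (2 * ival w.2 + 0))
  else k (clamp (ival w.1), clamp (2 * ival w.2 - 1))); split.
- apply: (@paste_continuous R _ _ (fun w : I * I => ival w.2) 2^-1
    (fun w => h (clamp (ival w.1), clamp (2 * ival w.2 + 0)))
    (fun w => k (clamp (ival w.1), clamp (2 * ival w.2 - 1)))).
  + exact: snd_ival_continuous.
  + apply: homotopy_comp_continuous => //; first exact: fst_ival_continuous.
    exact/affine_continuous/snd_ival_continuous.
  + apply: homotopy_comp_continuous => //; first exact: fst_ival_continuous.
    exact/affine_continuous/snd_ival_continuous.
  + move=> w /= ->; rewrite mulfV ?pnatr_eq0// addr0 subrr -/(zero : I) -/(one : I).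
    by rewrite (h1 _) (k0 _).
- move=> t /=; rewrite ival_zero invr_ge0 ler0n mulr0 addr0 ivalK.
  exact: h0.
- move=> t /=; rewrite ival_one ifF; last by apply/negbTE; rewrite -ltNge; lra.
  rewrite (_ : 2 * 1 - 1 = 1 :> R); last by lra.
  rewrite ivalK; exact: k1.
- by move=> s /=; rewrite ivalK hx kx if_same.
- by move=> s /=; rewrite ivalK hy ky if_same.
Qed.

Lemma path_cat_homotopic x y z (p p' : {path I from x to y})
    (q q' : {path I from y to z}) :
  path_homotopic p p' -> path_homotopic q q' ->
  path_homotopic (path_cat p q) (path_cat p' q').
Proof.
move=> [h [ch h0 h1 hx hy]] [k [ck k0 k1 kx ky]].
exists (fun w => if ival w.1 <= 2^-1
  then h (clamp (2 * ival w.1 + 0), clamp (ival w.2))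
  else k (clamp (2 * ival w.1 - 1), clamp (ival w.2))); split.
- apply: (@paste_continuous R _ _ (fun w : I * I => ival w.1) 2^-1
    (fun w => h (clamp (2 * ival w.1 + 0), clamp (ival w.2)))
    (fun w => k (clamp (2 * ival w.1 - 1), clamp (ival w.2)))).
  + exact: fst_ival_continuous.
  + apply: homotopy_comp_continuous => //; last exact: snd_ival_continuous.
    exact/affine_continuous/fst_ival_continuous.
  + apply: homotopy_comp_continuous => //; last exact: snd_ival_continuous.
    exact/affine_continuous/fst_ival_continuous.
  + move=> w /= ->; rewrite mulfV ?pnatr_eq0// addr0 subrr -/(zero : I) -/(one : I).
    by rewrite (hy _) (kx _).
- by move=> t /=; rewrite ivalK h0 k0 addr0.
- by move=> t /=; rewrite ivalK h1 k1 addr0.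
- move=> s /=; rewrite ival_zero invr_ge0 ler0n mulr0 addr0.
  exact: hx.
- move=> s /=; rewrite ival_one ifF; last by apply/negbTE; rewrite -ltNge; lra.
  rewrite (_ : 2 * 1 - 1 = 1 :> R); last by lra.
  exact: ky.
Qed.

Lemma path_rev_homotopic x y (p q : {path I from x to y}) :
  path_homotopic p q -> path_homotopic (path_rev p) (path_rev q).
Proof.
move=> [h [ch h0 h1 hx hy]].
exists (fun w => h (clamp (-1 * ival w.1 + 1), clamp (ival w.2))); split.
- apply: homotopy_comp_continuous => //; last exact: snd_ival_continuous.
  exact/affine_continuous/fst_ival_continuous.
- by move=> t /=; rewrite ivalK h0 mulN1r addrC.
- by move=> t /=; rewrite ivalK h1 mulN1r addrC.
- move=> s /=; rewrite ival_zero mulr0 add0r; exact: hy.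
- move=> s /=; rewrite ival_one mulr1 addNr; exact: hx.
Qed.

Lemma path_revK x y (p : {path I from x to y}) : path_rev (path_rev p) = p.
Proof.
apply/path_eqP => t; have t0 := ival_ge0 t; have t1 := ival_le1 t.
rewrite !path_revE clampK; last by apply/andP; split; lra.
by rewrite opprB addrC subrK path_clampE.
Qed.

Lemma path_rev_cat x y z (p : {path I from x to y}) (q : {path I from y to z}) :
  path_rev (path_cat p q) = path_cat (path_rev q) (path_rev p).
Proof.
apply/path_eqP => t; have t0 := ival_ge0 t; have t1 := ival_le1 t.
rewrite path_revE !path_catE !path_revE clampK; last by apply/andP; split; lra.
have [t2|t2] := leP (ival t) 2^-1.
  rewrite clampK; last by apply/andP; split; lra.
  have [t3|t3] := leP (1 - ival t) 2^-1; last by congr (q (clamp _)); lra.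
  by rewrite path_clamp1 ?path_clamp0//; lra.
rewrite ifT; last by lra.
rewrite clampK; last by apply/andP; split; lra.
by congr (p (clamp _)); lra.
Qed.

Lemma path_catA x y z w (p : {path I from x to y}) (q : {path I from y to z})
    (r : {path I from z to w}) :
  path_homotopic (path_cat (path_cat p q) r) (path_cat p (path_cat q r)).
Proof.
pose phi (t : I) : R :=
  Order.min (2 * ival t + 0) (Order.min (1 * ival t + 4^-1) (2^-1 * ival t + 2^-1)).
have phi1 t : ival t <= 4^-1 -> phi t = 2 * ival t.
  by move=> ?; rewrite /phi min_l ?addr0// le_min; apply/andP; split; lra.
have phi2 t : 4^-1 <= ival t -> ival t <= 2^-1 -> phi t = ival t + 4^-1.
  move=> ? ?; rewrite /phi mul1r (min_l (x := ival t + _)) ?min_r//; lra.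
have phi3 t : 2^-1 <= ival t -> phi t = 2^-1 * ival t + 2^-1.
  move=> ?; rewrite /phi (min_r (y := 2^-1 * _ + _)) ?min_r//; lra.
have cphi : continuous phi.
  have ca := fun a b => @affine_continuous R I ival a b (@ival_continuous R).
  move=> t; have := @continuous_min R I (fun t => 2 * ival t + 0)
    ((fun t => 1 * ival t + 4^-1) \min (fun t => 2^-1 * ival t + 2^-1)) t.
  apply; first exact: ca.
  have := @continuous_min R I (fun t => 1 * ival t + 4^-1)
    (fun t => 2^-1 * ival t + 2^-1) t.
  by apply; exact: ca.
apply: (@reparam_homotopic _ _ _ _ (path_cat p (path_cat q r)) _ _ phi ival).
- exact: cphi.
- exact: ival_continuous.
- by rewrite phi1 ival_zero ?mulr0// invr_ge0.
- by rewrite phi3 ival_one//; lra.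
- move=> t; have t0 := ival_ge0 t; have t1 := ival_le1 t.
  rewrite !path_catE.
  have [t2|t2] := leP (ival t) 2^-1.
    rewrite clampK; last by apply/andP; split; lra.
    have [t4|t4] := leP (2 * ival t) 2^-1.
      rewrite phi1; last lra.
      by rewrite clampK ?t4//; apply/andP; split; lra.
    rewrite phi2; [|lra..].
    rewrite clampK; last by apply/andP; split; lra.
    rewrite ifF; last by apply/negbTE; rewrite -ltNge; lra.
    rewrite clampK; last by apply/andP; split; lra.
    rewrite ifT; last by lra.
    by congr (q (clamp _)); lra.
  rewrite phi3; last lra.
  rewrite clampK; last by apply/andP; split; lra.
  rewrite ifF; last by apply/negbTE; rewrite -ltNge; lra.
  rewrite clampK; last by apply/andP; split; lra.
  rewrite ifF; last by apply/negbTE; rewrite -ltNge; lra.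
  by congr (r (clamp _)); lra.
- by move=> t; rewrite path_clampE.
Qed.

Lemma path_cat1p x y (p : {path I from x to y}) :
  path_homotopic (path_cat (path_cst x) p) p.
Proof.
apply: (@reparam_homotopic _ _ _ _ p _ _
  (fun t => ival (clamp (2 * ival t - 1))) ival).
- move=> t; apply: (@continuous_comp _ _ _ (fun t => clamp (2 * ival t - 1)) ival).
    apply: (@continuous_comp _ _ _ (fun t => 2 * ival t - 1) clamp).
      exact/affine_continuous/ival_continuous.
    exact: clamp_continuous.
  exact: ival_continuous.
- exact: ival_continuous.
- by rewrite ival_zero clamp_le0//; lra.
- by rewrite ival_one clamp_ge1//; lra.
- move=> t; rewrite ivalK path_catE.
  have [t2|//] := leP (ival t) 2^-1.
  by rewrite [RHS]path_clamp0//; lra.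
- by move=> t; rewrite path_clampE.
Qed.

Lemma path_catp1 x y (p : {path I from x to y}) :
  path_homotopic (path_cat p (path_cst y)) p.
Proof.
apply: (@reparam_homotopic _ _ _ _ p _ _
  (fun t => ival (clamp (2 * ival t + 0))) ival).
- move=> t; apply: (@continuous_comp _ _ _ (fun t => clamp (2 * ival t + 0)) ival).
    apply: (@continuous_comp _ _ _ (fun t => 2 * ival t + 0) clamp).
      exact/affine_continuous/ival_continuous.
    exact: clamp_continuous.
  exact: ival_continuous.
- exact: ival_continuous.
- by rewrite ival_zero clamp_le0//; lra.
- by rewrite ival_one clamp_ge1//; lra.
- move=> t; rewrite ivalK addr0 path_catE.
  have [//|t2] := leP (ival t) 2^-1.
  by rewrite [RHS]path_clamp1//; lra.
- by move=> t; rewrite path_clampE.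
Qed.

Lemma path_catpV x y (p : {path I from x to y}) :
  path_homotopic (path_cat p (path_rev p)) (path_cst x).
Proof.
apply: (@reparam_homotopic _ _ _ _ p _ _
  (fun t => Order.min (2 * ival t + 0) (-2 * ival t + 2)) (cst 0)).
- have ca := fun a b => @affine_continuous R I ival a b (@ival_continuous R).
  move=> t; have := @continuous_min R I (fun t => 2 * ival t + 0)
    (fun t => -2 * ival t + 2) t.
  by apply; exact: ca.
- exact: cst_continuous.
- by rewrite ival_zero !mulr0 !add0r min_l ?ler0n.
- by rewrite ival_one !mulr1 addr0 addNr min_r ?ler0n.
- move=> t; have t0 := ival_ge0 t; have t1 := ival_le1 t.
  rewrite path_catE.
  have [t2|t2] := leP (ival t) 2^-1.
    by rewrite min_l ?addr0//; lra.
  rewrite min_r; last lra.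
  rewrite !path_revE clampK; last by apply/andP; split; lra.
  by congr (p (clamp _)); lra.
- by move=> t; rewrite path_clamp0.
Qed.

Lemma path_catVp x y (p : {path I from x to y}) :
  path_homotopic (path_cat (path_rev p) p) (path_cst y).
Proof. by have := path_catpV (path_rev p); rewrite path_revK. Qed.

End homotopy_theory.

Section fundamental_group.
Context {R : realType} {X : topologicalType} (x : X).
Local Notation I := (unit_interval R).
Local Notation L := {path I from x to x}.

Definition homotopic_rel : rel L := fun p q => `[< path_homotopic p q >].

Lemma homotopic_rel_refl : reflexive homotopic_rel.
Proof. by move=> p; apply/asboolP/path_homotopic_refl. Qed.

Lemma homotopic_rel_sym : symmetric homotopic_rel.
Proof.
by move=> p q; apply/idP/idP => /asboolP /path_homotopic_sym /asboolP.
Qed.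

Lemma homotopic_rel_trans : transitive homotopic_rel.
Proof.
move=> q p r /asboolP pq /asboolP qr.
by apply/asboolP; exact: path_homotopic_trans pq qr.
Qed.

Canonical homotopic_equiv := EquivRel homotopic_rel
  homotopic_rel_refl homotopic_rel_sym homotopic_rel_trans.

End fundamental_group.

(* The library topologizes {path i from x to y} by the compact-open topology, so
   the quotient topology below is that of the quasitopological fundamental
   group. *)
Definition pi1 (R : realType) (X : topologicalType) (x : X) : Type :=
  quotient_topology {eq_quot (@homotopic_equiv R X x)}.

Section fundamental_group_structure.
Context {R : realType} {X : topologicalType} (x : X).
Local Notation I := (unit_interval R).
Local Notation L := {path I from x to x}.
Local Notation G := (@pi1 R X x).

HB.instance Definition _ := Topological.on G.
HB.instance Definition _ := Quotient.on G.

Definition pi1_class (p : L) : G := \pi_G p.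

Lemma pi1_openE (A : set G) : open A = open (pi1_class @^-1` A).
Proof. by []. Qed.

Lemma pi1_classP (p q : L) : pi1_class p = pi1_class q <-> path_homotopic p q.
Proof.
have H := @eqmodP _ (@homotopic_equiv R X x) p q.
by split => [/H /asboolP|pq]; last exact/H/asboolP.
Qed.

Lemma pi1_classK (g : G) : pi1_class (repr g) = g.
Proof. exact: reprK. Qed.

Lemma pi1_repr_homotopic (p : L) : path_homotopic (repr (pi1_class p)) p.
Proof. by apply/pi1_classP; rewrite pi1_classK. Qed.

Definition pi1_one : G := pi1_class (path_cst x).
Definition pi1_inv (a : G) : G := pi1_class (path_rev (repr a)).
Definition pi1_mul (a b : G) : G := pi1_class (path_cat (repr a) (repr b)).

Lemma pi1_mul_class (p q : L) :
  pi1_mul (pi1_class p) (pi1_class q) = pi1_class (path_cat p q).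
Proof.
by apply/pi1_classP; apply: path_cat_homotopic; exact: pi1_repr_homotopic.
Qed.

Lemma pi1_inv_class (p : L) : pi1_inv (pi1_class p) = pi1_class (path_rev p).
Proof. by apply/pi1_classP/path_rev_homotopic; exact: pi1_repr_homotopic. Qed.

Lemma pi1_mulA : associative pi1_mul.
Proof.
move=> a b c; rewrite -(pi1_classK a) -(pi1_classK b) -(pi1_classK c).
rewrite !pi1_mul_class; apply/pi1_classP/path_homotopic_sym.
exact: path_catA.
Qed.

Lemma pi1_mul1g : left_id pi1_one pi1_mul.
Proof.
move=> a; rewrite -(pi1_classK a) pi1_mul_class.
by apply/pi1_classP; exact: path_cat1p.
Qed.

Lemma pi1_mulg1 : right_id pi1_one pi1_mul.
Proof.
move=> a; rewrite -(pi1_classK a) pi1_mul_class.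
by apply/pi1_classP; exact: path_catp1.
Qed.

Lemma pi1_mulVg : left_inverse pi1_one pi1_inv pi1_mul.
Proof.
move=> a; rewrite -(pi1_classK a) pi1_inv_class pi1_mul_class.
by apply/pi1_classP; exact: path_catVp.
Qed.

Lemma pi1_mulgV : right_inverse pi1_one pi1_inv pi1_mul.
Proof.
move=> a; rewrite -(pi1_classK a) pi1_inv_class pi1_mul_class.
by apply/pi1_classP; exact: path_catpV.
Qed.

HB.instance Definition _ := isGroup.Build G
  pi1_mulA pi1_mul1g pi1_mulg1 pi1_mulVg pi1_mulgV.

End fundamental_group_structure.

(* conjg is on the right: (h ^ g)%g = g^-1 * (h * g). *)
Definition group_core (G : groupType) (H : set G) : set G :=
  \bigcap_(g in [set: G]) [set (h ^ g)%g | h in H].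

Definition path_connected (R : realType) (X : topologicalType) (A : set X) :=
  forall a b, A a -> A b ->
  exists p : {path unit_interval R from a to b}, range p `<=` A.

Definition locally_path_connected (R : realType) (X : topologicalType) :=
  forall (y : X) (A : set X), nbhs y A ->
  exists V : set X, [/\ open_nbhs y V, path_connected R V & V `<=` A].

Section spanier.
Context {R : realType} {X : topologicalType} {J : Type}.
Variables (U : J -> set X) (x : X).
Local Notation I := (unit_interval R).

Definition lasso (l : {path I from x to x}) : Prop :=
  exists (y : X) (u : {path I from x to y}) (v : {path I from y to y}),
    (exists j, range v `<=` U j) /\ l = path_cat (path_cat u v) (path_rev u).

Definition path_prod (s : seq {path I from x to x}) : {path I from x to x} :=
  foldr (@path_cat R X x x x) (path_cst x) s.

(* The empty product is allowed; it represents the neutral element. *)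
Definition spanier : set (pi1 R x) :=
  [set pi1_class (path_prod s) | s in [set s | forall l, l \in s -> lasso l]].

Lemma pi1_class_prod s :
  pi1_class (path_prod s) = (\prod_(l <- s) pi1_class l)%g.
Proof.
elim: s => [|l s IH]; first by rewrite big_nil.
by rewrite big_cons -IH /= -pi1_mul_class.
Qed.

Lemma lasso_inv l : lasso l ->
  exists2 l', lasso l' & (pi1_class l)^-1%g = pi1_class l'.
Proof.
move=> [y [u [v [[j vU] ->]]]].
exists (path_cat (path_cat u (path_rev v)) (path_rev u)).
  exists y, u, (path_rev v); split=> //; exists j => _ [t _ <-].
  by apply: vU; exists (clamp (1 - ival t)).
rewrite -[LHS]/(pi1_inv _) pi1_inv_class; apply/pi1_classP.
rewrite !path_rev_cat path_revK; apply: path_homotopic_sym; exact: path_catA.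
Qed.

Lemma spanier_group_closed : group_closed [in spanier].
Proof.
split.
  by apply/mem_set; exists [::].
move=> a b /set_mem [s sl <-] /set_mem [r rl <-]; apply/mem_set.
have [r' r'l ->] : exists2 r', (forall l, l \in r' -> lasso l) &
    (pi1_class (path_prod r))^-1%g = pi1_class (path_prod r').
  elim: r rl => [|l r IH] rl.
    by exists [::] => //; rewrite pi1_class_prod big_nil invg1.
  have [k kr|r' r'l rr'] := IH; first by apply: rl; rewrite inE kr orbT.
  have [l' ll' lE] := lasso_inv (rl l (mem_head _ _)).
  exists (rcons r' l') => [k|].
    by rewrite mem_rcons inE => /predU1P[->//|/r'l].
  rewrite !pi1_class_prod big_cons big_rcons/= invgM lE.
  by rewrite -!pi1_class_prod rr'.
exists (s ++ r'); last by rewrite !pi1_class_prod big_cat.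
by move=> l /=; rewrite mem_cat => /orP[/sl|/r'l].
Qed.

End spanier.

Arguments lasso R {X J} U x l : rename.
Arguments spanier R {X J} U x : rename.

(* Main.v *)
Require Import Defs.
From mathcomp Require Import all_boot all_order all_algebra.
From mathcomp Require Import all_classical all_reals topology normedtype.
From mathcomp Require Import homotopy.

(** If [y] is the end of a path [u] from [x], the loops [u v u^-1] converge to
    [u u^-1] in the compact-open topology as the loop [v] shrinks to [y].  Since
    [u u^-1] is null-homotopic and the core [N] of [H] is open, there is an open
    neighbourhood [V] of [y] such that [u v u^-1] represents an element of [N] for
    all loops [v] at [y] in [V]; by local path connectedness [V] may be taken path
    connected.  Any lasso around a loop in [V] is then homotopic to a conjugate of
    such a [u v u^-1], hence lies in [H].  If no path from [x] reaches [y], then no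
    lasso reaches a path connected neighbourhood of [y]. *)

Set Implicit Arguments.
Unset Strict Implicit.
Unset Printing Implicit Defensive.

Local Open Scope classical_set_scope.

(** Membership in the conjugate by [g^-1] writes [a] as [h ^ g^-1] with [h] in [H]; conjugating by
    [g] gives back [h]. *)
Lemma group_core_conjg (G : groupType) (H : set G) (a g : G) :
  group_core H a -> H (a ^ g)%g.
Proof. by move=> /(_ g^-1%g I)[h Hh <-]; rewrite -conjgM mulVg conjg1. Qed.

Lemma group_core1 (G : groupType) (H : set G) :
  H 1%g -> group_core H 1%g.
Proof. by move=> H1 g _; exists 1%g => //; rewrite conj1g. Qed.

Section lassos.
Context {R : realType} {X : topologicalType}.
Local Notation I := (unit_interval R).
Implicit Types x y z : X.

Definition path_conj x y (u : {path I from x to y}) (v : {path I from y to y}) :=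
  path_cat (path_cat u v) (path_rev u).

Lemma path_conj_cst x y (u : {path I from x to y}) :
  path_homotopic (path_conj u (path_cst y)) (path_cst x).
Proof.
apply: path_homotopic_trans (path_catpV u).
by apply: path_cat_homotopic; [exact: path_catp1|exact: path_homotopic_refl].
Qed.

Lemma path_cat_range x y z (p : {path I from x to y}) (q : {path I from y to z})
    (A : set X) :
  range p `<=` A -> range q `<=` A -> range (path_cat p q) `<=` A.
Proof.
by move=> pA qA _ [t _ <-]; rewrite path_catE; case: ifP => _;
  [apply: pA|apply: qA]; eexists.
Qed.

Lemma path_rev_range x y (p : {path I from x to y}) (A : set X) :
  range p `<=` A -> range (path_rev p) `<=` A.
Proof. by move=> pA _ [t _ <-]; apply: pA; eexists. Qed.

(** At time [t] the concatenation runs either along [u] or its reverse, where [v] is not read, or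
    along [v], at a time [s] fixed by the parametrization alone. Compact-open convergence can thus
    be checked pointwise, without cutting the compact set. *)
Lemma path_conjP x y (u : {path I from x to y}) (t : I) :
  (forall v w, path_conj u v t = path_conj u w t) \/
  exists s, forall v, path_conj u v t = v s.
Proof.
rewrite /path_conj; case: (boolP (ival t <= 2^-1)%R) => t2; last first.
  by left=> v w; rewrite !path_catE (negbTE t2).
case: (boolP (ival (clamp (2 * ival t)) <= 2^-1)%R) => s2.
  by left=> v w; rewrite !path_catE t2 s2.
by right; eexists => v; rewrite !path_catE t2 (negbTE s2).
Qed.

Lemma path_conj_shrink x y (u : {path I from x to y})
    (A : set {path I from x to x}) :
  nbhs (path_conj u (path_cst y)) A ->
  exists2 V, open_nbhs y V &
    forall v : {path I from y to y}, range v `<=` V -> A (path_conj u v).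
Proof.
(* The path space has the topology induced from the function space, so [A] contains the trace of an
   open set [B] of functions. *)
move=> [_ [[B oB <-] Bf BA]].
pose F : set_system {compact-open, I -> X} :=
  filter_from (open_nbhs y)
    (fun V => [set (path_conj u v : I -> X) |
               v in [set v : {path I from y to y} | range v `<=` V]]).
have FF : Filter F.
  apply: filter_from_filter; first by exists setT; split=> //; exact: openT.
  move=> V W yV yW; exists (V `&` W); first exact: open_nbhsI.
  by move=> _ [v vVW <-]; split; exists v => // z /vVW[].
have Fcvg : F --> (path_conj u (path_cst y) : {compact-open, I -> X}).
  apply/compact_open_cvgP => K O cK oO fKO.
  (* If [y] lies in [O], loops inside [O] work. Otherwise no time in [K] reads the loop, since the
     constant loop would take the value [y] there; then all loops work. *)
  have [Oy|nOy] := pselect (O y).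
    exists O => // _ [v vO <-] _ [t Kt <-].
    have [E|[s E]] := path_conjP u t; last by rewrite E; apply: vO; exists s.
    by rewrite (E _ (path_cst y)); apply: fKO; exists t.
  exists setT; first by split=> //; exact: openT.
  move=> _ [v _ <-] _ [t Kt <-].
  have [E|[s E]] := path_conjP u t.
    by rewrite (E _ (path_cst y)); apply: fKO; exists t.
  by case: nOy; apply: fKO; exists t => //; rewrite E.
have [V yV VB] : F B by apply: Fcvg; exact: open_nbhs_nbhs.
by exists V => // v vV; apply: BA; apply: VB; exists v.
Qed.

Lemma path_homotopic_catl x y z (q : {path I from y to z})
    (p p' : {path I from x to y}) :
  path_homotopic p p' -> path_homotopic (path_cat p q) (path_cat p' q).
Proof. by move=> pp'; exact: path_cat_homotopic pp' (path_homotopic_refl q). Qed.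

Lemma path_homotopic_catr x y z (p : {path I from x to y})
    (q q' : {path I from y to z}) :
  path_homotopic q q' -> path_homotopic (path_cat p q) (path_cat p q').
Proof. exact: path_cat_homotopic (path_homotopic_refl p). Qed.

Lemma path_cat_cancel x y z w (p : {path I from x to y})
    (q : {path I from z to y}) (r : {path I from y to w}) :
  path_homotopic (path_cat (path_cat p (path_rev q)) (path_cat q r))
                 (path_cat p r).
Proof.
apply: path_homotopic_trans (path_catA _ _ _) _.
apply: path_homotopic_catr.
apply: path_homotopic_trans (path_homotopic_sym (path_catA _ _ _)) _.
apply: path_homotopic_trans (path_cat1p _).
exact/path_homotopic_catl/path_catVp.
Qed.

Lemma path_conj_cat x y z (u : {path I from x to y}) (p : {path I from y to z})
    (v : {path I from z to z}) :
  path_homotopic (path_conj u (path_conj p v)) (path_conj (path_cat u p) v).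
Proof.
rewrite /path_conj path_rev_cat; apply: path_homotopic_trans (path_catA _ _ _).
apply: path_homotopic_catl.
apply: path_homotopic_trans (path_homotopic_sym (path_catA _ _ _)) _.
exact/path_homotopic_catl/path_homotopic_sym/path_catA.
Qed.

(** With [g] the class of [u p w^-1], both [g [w v w^-1]] and [[u p v p^-1 u^-1] g] cancel down to
    the class of [u p v w^-1]. *)
Lemma pi1_class_conj_conjg x y z (u : {path I from x to y})
    (p : {path I from y to z}) (w : {path I from x to z})
    (v : {path I from z to z}) :
  pi1_class (path_conj w v) =
  (pi1_class (path_conj u (path_conj p v)) ^
   pi1_class (path_cat (path_cat u p) (path_rev w)))%g.
Proof.
apply/(canRL (mulKg _)); rewrite -[LHS]/(pi1_mul _ _) -[RHS]/(pi1_mul _ _).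
rewrite !pi1_mul_class; apply/pi1_classP.
apply: (@path_homotopic_trans _ _ _ _
  (path_cat (path_cat (path_cat u p) v) (path_rev w))).
  apply: path_homotopic_trans (path_homotopic_sym (path_catA _ _ _)) _.
  exact/path_homotopic_catl/path_cat_cancel.
apply: path_homotopic_sym.
apply: path_homotopic_trans (path_homotopic_catl _ (path_conj_cat _ _ _)) _.
exact: path_cat_cancel.
Qed.

End lassos.

Theorem corollary2p3 (R : realType) (X : topologicalType) (x : X)
    (H : set (pi1 R x)) :
  locally_path_connected R X ->
  group_closed [in H] ->
  open (group_core H) ->
  exists (J : Type) (U : J -> set X),
    [/\ forall j, open (U j), \bigcup_j U j = [set: X] & spanier R U x `<=` H].
Proof.
move=> lpc Hgrp oN.
pose lassos_in_H (V : set X) := forall z (w : {path unit_interval R from x to z})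
  (v : {path unit_interval R from z to z}),
  range v `<=` V -> H (pi1_class (path_conj w v)).
have base_in V z (v : {path unit_interval R from z to z}) : range v `<=` V -> V z.
  by apply; exists zero => //; exact: path_zero.
have cover y : exists V, [/\ open V, V y & lassos_in_H V].
  have [[u]|nu] := pselect (inhabited {path unit_interval R from x to y}).
    have : nbhs (path_conj u (path_cst y)) (@pi1_class R X x @^-1` group_core H).
      apply: open_nbhs_nbhs; split; first by rewrite pi1_openE in oN.
      rewrite /preimage /= ((pi1_classP _ _).2 (path_conj_cst u)).
      by apply: group_core1; exact: set_mem Hgrp.1.
    move=> /path_conj_shrink[W yW WN].
    have [V [[oV yV] pcV VW]] := lpc y W (open_nbhs_nbhs yW).
    (* The path [p] inside [V] carries the loop [v] at [z] to the loop [p v p^-1] at [y], to which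
       [WN] applies. *)
    exists V; split=> // z w v vV; have [p pV] := pcV y z yV (base_in _ _ _ _ vV).
    have pvV : range (path_conj p v) `<=` V.
      exact: path_cat_range (path_cat_range pV vV) (path_rev_range pV).
    (* The tail [w] is arbitrary, so [H] must absorb a conjugation; this is why the smaller loops
       were placed in the core. *)
    rewrite (pi1_class_conj_conjg u p).
    by apply: group_core_conjg; apply: (WN (path_conj p v)) => r /pvV/VW.
  have [V [[oV yV] pcV _]] := lpc y setT filterT.
  (* The condition on [V] is vacuous: a tail [w] ending in [V], continued by [p], would join [x] to
     [y]. *)
  exists V; split=> // z w v vV; have [p _] := pcV z y (base_in _ _ _ _ vV) yV.
  by case: nu; split; exact: path_cat w p.
(* Indexing by all suitable open sets avoids choosing one for each point. *)
exists {V | open V /\ lassos_in_H V}, (fun V => sval V); split.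
- by case=> V [].
- apply/seteqP; split=> // y _; have [V [oV yV HV]] := cover y.
  by exists (exist _ V (conj oV HV)).
- move=> _ [s sl <-]; rewrite pi1_class_prod.
  elim: s sl => [|l s IH] sl; first by rewrite big_nil; exact: set_mem Hgrp.1.
  rewrite big_cons; apply/set_mem.
  apply: (group_closedM Hgrp); apply/mem_set.
    have [y [w [v [[[V [_ VH]] /= vV] ->]]]] := sl l (mem_head _ _).
    exact: VH.
  by apply: IH => k ks; apply: sl; rewrite inE ks orbT.
Qed.
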